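(* The CH-shape cohomology groups satisfy the excision axiom: if $(X,X_0)$ is a Hausdorff space pair and $W$ is an open subset of $X$ with $\overline{W}\subset\mathrm{int}\,X_0$, then for each $n\in\mathbb N$ the homomorphism $$\hat i^n:\hat H^n(X,X_0)\to\hat H^n(X\setminus W,X_0\setminus W)$$ induced by the inclusion $i:(X\setminus W,X_0\setminus W)\to(X,X_0)$ is an isomorphism.
   Context: $\mathbb N=\{0,1,2,\dots\}$. Maps are continuous. A Hausdorff space pair $(X,X_0)$ is a Hausdorff space $X$ with a subset $X_0\subset X$. A map of pairs $(X,X_0)\to(Y,Y_0)$ is a map $X\to Y$ sending $X_0$ into $Y_0$. Closure $\overline{W}$ and interior $\mathrm{int}\,X_0$ are taken in $X$. Fix an abelian coefficient group $G$, omitted from notation; $H^n$ is singular cohomology. For a Hausdorff space pair $(X,X_0)$ let $c(X,X_0)$ be the set of pairs $(K,K_0)$ with $K,K_0$ compact, $K_0\subset K\subset X$, $K_0\subset X_0$, directed by $(K,K_0)\le(K',K_0')$ iff $K\subset K'$ and $K_0\subset K_0'$. The $n$-th CH-shape cohomology group is the inverse limit $$\hat H^n(X,X_0)=\varprojlim_{(K,K_0)\in c(X,X_0)}H^n(K,K_0)$$ with bonding homomorphisms induced by inclusions. Induced homomorphism: for a map of pairs $\varphi:(X,X_0)\to(Y,Y_0)$, $\hat\varphi^n:\hat H^n(Y,Y_0)\to\hat H^n(X,X_0)$ is the homomorphism whose component at $(K,K_0)\in c(X,X_0)$ is the canonical projection $\hat H^n(Y,Y_0)\to H^n(\varphi(K),\varphi(K_0))$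 followed by the homomorphism $H^n(\varphi(K),\varphi(K_0))\to H^n(K,K_0)$ induced by $\varphi|_K$. *)

(* Defs.v *)
From HB Require Import structures.
From mathcomp Require Import all_boot all_order all_algebra.
From mathcomp Require Import all_classical reals topology normedtype.
Import Order.TTheory GRing.Theory Num.Theory.
Import numFieldNormedType.Exports.

Set Implicit Arguments.
Unset Strict Implicit.
Unset Printing Implicit Defensive.

Local Open Scope classical_set_scope.
Local Open Scope ring_scope.

(* Subsets are turned into spaces by [set_type], which carries the subspace   *)
(* topology.                                                                  *)

Lemma continuous_set_type (X Y : topologicalType) (B : set Y)
    (f : X -> set_type B) :
  continuous (fun x => set_val (f x)) -> continuous f.
Proof.
move=> /continuousP cf; apply/continuousP => _ [U oU <-].
exact: (cf U oU).
Qed.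

Lemma set_val_continuous (X : topologicalType) (A : set X) :
  continuous (set_val : set_type A -> X).
Proof. exact: initial_continuous. Qed.

HB.instance Definition _ (X : topologicalType) (A : set X) :=
  @isContinuous.Build (set_type A) X set_val (@set_val_continuous X A).

Definition trace (X : topologicalType) (A B : set X) : set (set_type A) :=
  set_val @^-1` B.
Arguments trace {X} A B.

Definition std_simplex_set (R : realType) (n : nat) : set 'rV[R]_n.+1 :=
  [set t | (forall j, 0 <= t 0 j) /\ \sum_j t 0 j = 1].
Arguments std_simplex_set : clear implicits.

Notation std_simplex R n := (set_type (std_simplex_set R n)).

Section Faces.
Context (R : realType) (n : nat) (i : 'I_n.+2).

Definition face_row (t : 'rV[R]_n.+1) : 'rV[R]_n.+2 :=
  \row_j if unlift i j is Some k then t 0 k else 0.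

Lemma face_row_simplex (t : 'rV[R]_n.+1) :
  std_simplex_set R n t -> std_simplex_set R n.+1 (face_row t).
Proof.
move=> [t0 t1]; split=> [j|].
  by rewrite mxE; case: unliftP.
rewrite (bigD1_ord i) //= mxE unlift_none add0r -[RHS]t1.
by apply: eq_bigr => k _; rewrite mxE liftK.
Qed.

Definition face_fun (t : std_simplex R n) : std_simplex R n.+1 :=
  exist _ (face_row (set_val t)) (mem_set (face_row_simplex (set_valP t))).

Lemma face_row_continuous : continuous face_row.
Proof.
move=> t A [P nP sPA]; rewrite nbhs_simpl /=.
exists (fun a k => P a (lift i k)) => [a k|N PN].
  by have := nP a (lift i k); rewrite mxE liftK ord1.
apply: sPA => a j; rewrite (ord1 a) mxE.
case: unliftP => [k ->|ji]; first exact: PN.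
by have /nbhs_singleton := nP 0 j; rewrite mxE ji unlift_none.
Qed.

Lemma face_fun_continuous : continuous face_fun.
Proof.
apply: continuous_set_type => t.
apply: (continuous_comp (f := set_val) (g := face_row)).
  exact: set_val_continuous.
exact: face_row_continuous.
Qed.

HB.instance Definition _ :=
  @isContinuous.Build _ _ face_fun face_fun_continuous.

Definition face : continuousType (std_simplex R n) (std_simplex R n.+1) :=
  face_fun.

End Faces.

(* A homomorphism from the free abelian group on the singular n-simplices of  *)
(* X to G is encoded by its values on the generators, so that homomorphisms   *)
(* out of S_n(X) / S_n(X0) are the cochains vanishing on simplices in X0.     *)

Notation singular_simplex R n X := (continuousType (std_simplex R n) X).

Notation cochain R G n X := (singular_simplex R n X -> G).

Section Cohomology.
Context (R : realType) (G : zmodType).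

Definition coboundary (X : topologicalType) (n : nat)
    (c : cochain R G n X) : cochain R G n.+1 X :=
  fun s => \sum_(i < n.+2) c (s \o face R i) *~ (-1) ^+ i.

Section Pair.
Context (X : topologicalType) (X0 : set X).

Definition rel_cochain (n : nat) : set (cochain R G n X) :=
  [set c | forall s : singular_simplex R n X, range s `<=` X0 -> c s = 0].
Arguments rel_cochain : clear implicits.

Definition is_cocycle (n : nat) : {pred cochain R G n X} :=
  fun c => `[< rel_cochain n c /\ coboundary c = 0 >].

Definition rel_coboundary (n : nat) : set (cochain R G n X) :=
  match n with
  | 0 => [set 0]
  | m.+1 => [set coboundary b | b in rel_cochain m]
  end.
Arguments rel_coboundary : clear implicits.

Lemma coboundaryB n : {morph @coboundary X n : c d / c - d}.
Proof.
move=> c d; apply/funext => s; rewrite /coboundary /= !fctE.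
by rewrite -sumrB; apply: eq_bigr => i _; rewrite mulrzBl.
Qed.

Lemma coboundary0 n : @coboundary X n 0 = 0.
Proof. by rewrite -[X in coboundary X](subrr 0) coboundaryB subrr. Qed.

Lemma rel_cochain0 n : rel_cochain n 0.
Proof. by []. Qed.

Lemma rel_cochainB n c d :
  rel_cochain n c -> rel_cochain n d -> rel_cochain n (c - d).
Proof. by move=> hc hd s sX0; rewrite !fctE hc ?hd ?subrr. Qed.

Lemma is_cocycle_zmod_closed n : zmod_closed (@is_cocycle n).
Proof.
split; first by apply/asboolP; split; [exact: rel_cochain0|exact: coboundary0].
move=> c d /asboolP[hc dc] /asboolP[hd dd]; apply/asboolP.
by split; [exact: rel_cochainB|rewrite coboundaryB dc dd subrr].
Qed.

HB.instance Definition _ n :=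
  GRing.isZmodClosed.Build _ (@is_cocycle n) (@is_cocycle_zmod_closed n).

Record cocycle n := Cocycle {
  cocycle_val :> cochain R G n X ;
  _ : cocycle_val \in @is_cocycle n }.

HB.instance Definition _ n := [isSub for @cocycle_val n].
HB.instance Definition _ n := [Choice of cocycle n by <:].
HB.instance Definition _ n := [SubChoice_isSubZmodule of cocycle n by <:].

Definition is_coboundary (n : nat) : {pred cocycle n} :=
  fun z => `[< rel_coboundary n (cocycle_val z) >].

Lemma is_coboundary_zmod_closed n : zmod_closed (@is_coboundary n).
Proof.
split.
  apply/asboolP; case: n => [|n]//=.
  by exists 0; [exact: rel_cochain0|exact: coboundary0].
move=> c d /asboolP hc /asboolP hd; apply/asboolP.
case: n c d hc hd => [|n] c d /=; first by move=> -> ->; rewrite subrr.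
move=> [b hb <-] [e he <-]; exists (b - e); first exact: rel_cochainB.
exact: coboundaryB.
Qed.

HB.instance Definition _ n :=
  GRing.isZmodClosed.Build _ (@is_coboundary n) (@is_coboundary_zmod_closed n).

Definition cohomology (n : nat) : Type :=
  Quotient.quot (@is_coboundary n : zmodClosed (cocycle n)).

HB.instance Definition _ n := GRing.Zmodule.on (cohomology n).

Definition cohomology_class n (z : cocycle n) : cohomology n :=
  (\pi_(cohomology n) z)%qT.

Lemma cohomology_class_eq n (y z : cocycle n) :
  cohomology_class y = cohomology_class z <-> y - z \in @is_coboundary n.
Proof.
by rewrite /cohomology_class; split=> [/eqP|h]; [|apply/eqP];
  rewrite -Quotient.idealrBE.
Qed.

Lemma cohomology_classB n : {morph @cohomology_class n : y z / y - z}.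
Proof. by move=> y z; rewrite /cohomology_class !piE. Qed.

Lemma cohomology_class_repr n (x : cohomology n) :
  cohomology_class (repr x) = x.
Proof. exact: reprK. Qed.

End Pair.
End Cohomology.

Record pair_map (X Y : topologicalType) (X0 : set X) (Y0 : set Y) := PairMap {
  pair_map_fun :> continuousType X Y ;
  pair_map_sub : pair_map_fun @` X0 `<=` Y0 }.

Section InducedMap.
Context (R : realType) (G : zmodType) (X Y : topologicalType).
Context (X0 : set X) (Y0 : set Y) (f : pair_map X0 Y0).

Definition pullback (n : nat) (c : cochain R G n Y) : cochain R G n X :=
  fun s => c (f \o s).

Lemma coboundary_pullback n (c : cochain R G n Y) :
  coboundary (pullback c) = pullback (coboundary c).
Proof.
apply/funext => s; apply: eq_bigr => i _; congr (c _ *~ _).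
exact/continuousEP.
Qed.

Lemma rel_cochain_pullback n (c : cochain R G n Y) :
  rel_cochain Y0 c -> rel_cochain X0 (pullback c).
Proof.
move=> hc s sX0; apply: hc => _ [t _ <-].
by apply: (@pair_map_sub _ _ _ _ f); exists (s t) => //; apply: sX0; exists t.
Qed.

Lemma is_cocycle_pullback n (z : cocycle R G Y0 n) :
  pullback z \in @is_cocycle R G X X0 n.
Proof.
case: z => c /= /asboolP[hc dc]; apply/asboolP; split.
  exact: rel_cochain_pullback.
by rewrite coboundary_pullback dc.
Qed.

Definition cocycle_pullback n (z : cocycle R G Y0 n) : cocycle R G X0 n :=
  Cocycle (is_cocycle_pullback z).

Lemma cocycle_pullbackB n : {morph @cocycle_pullback n : y z / y - z}.
Proof. by move=> y z; apply: val_inj; rewrite raddfB. Qed.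

Lemma is_coboundary_pullback n (z : cocycle R G Y0 n) :
  z \in @is_coboundary R G Y Y0 n ->
  cocycle_pullback z \in @is_coboundary R G X X0 n.
Proof.
move=> /asboolP hz; apply/asboolP.
case: n z hz => [|n] z /=; first by move=> ->.
move=> [b hb dbz]; exists (pullback b); first exact: rel_cochain_pullback.
by rewrite coboundary_pullback dbz.
Qed.

Definition cohomology_map n (x : cohomology R G Y0 n) : cohomology R G X0 n :=
  cohomology_class (cocycle_pullback (repr x)).

Lemma cohomology_mapE n (z : cocycle R G Y0 n) :
  cohomology_map (cohomology_class z) = cohomology_class (cocycle_pullback z).
Proof.
apply/cohomology_class_eq; rewrite -cocycle_pullbackB.
apply: is_coboundary_pullback; apply/cohomology_class_eq.
exact: cohomology_class_repr.
Qed.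

Lemma cohomology_map_zmod_morphism n : zmod_morphism (@cohomology_map n).
Proof.
move=> x y; rewrite -(cohomology_class_repr x) -(cohomology_class_repr y).
by rewrite -cohomology_classB !cohomology_mapE cocycle_pullbackB cohomology_classB.
Qed.

HB.instance Definition _ n :=
  GRing.isZmodMorphism.Build _ _ (@cohomology_map n)
    (@cohomology_map_zmod_morphism n).

End InducedMap.

Lemma cohomology_map_square (R : realType) (G : zmodType)
    (X Y Y' Z : topologicalType)
    (X0 : set X) (Y0 : set Y) (Y0' : set Y') (Z0 : set Z)
    (f : pair_map X0 Y0) (g : pair_map Y0 Z0)
    (f' : pair_map X0 Y0') (g' : pair_map Y0' Z0) n
    (x : cohomology R G Z0 n) :
  (forall t, g (f t) = g' (f' t)) ->
  cohomology_map f (cohomology_map g x) =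
  cohomology_map f' (cohomology_map g' x).
Proof.
move=> gf; rewrite -(cohomology_class_repr x) !cohomology_mapE.
congr cohomology_class; apply: val_inj; apply/funext => s /=.
by rewrite /pullback; congr (cocycle_val _ _); apply/continuousEP => t /=.
Qed.

Section InverseLimit.
Context (I : Type) (le : I -> I -> Prop) (M : I -> zmodType).
Context (bond : forall i j, le i j -> {additive M j -> M i}).

Record inverse_limit := InverseLimit {
  limit_proj :> forall i, M i ;
  limit_compat : forall i j (ij : le i j),
    bond ij (limit_proj j) = limit_proj i }.

Lemma inverse_limitP (x y : inverse_limit) : (forall i, x i = y i) -> x = y.
Proof.
case: x y => [x hx] [y hy] /= xy.
have {}xy : x = y by exact: functional_extensionality_dep.
by rewrite xy in hx *; congr InverseLimit; exact: Prop_irrelevance.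
Qed.

HB.instance Definition _ := gen_eqMixin inverse_limit.
HB.instance Definition _ := gen_choiceMixin inverse_limit.

Definition limit_zero : inverse_limit.
Proof. by exists (fun i => 0) => i j ij; rewrite raddf0. Defined.

Definition limit_opp (x : inverse_limit) : inverse_limit.
Proof.
by exists (fun i => - x i) => i j ij; rewrite raddfN limit_compat.
Defined.

Definition limit_add (x y : inverse_limit) : inverse_limit.
Proof.
by exists (fun i => x i + y i) => i j ij; rewrite raddfD !limit_compat.
Defined.

Lemma limit_addA : associative limit_add.
Proof. by move=> x y z; apply: inverse_limitP => i /=; rewrite addrA. Qed.

Lemma limit_addC : commutative limit_add.
Proof. by move=> x y; apply: inverse_limitP => i /=; rewrite addrC. Qed.

Lemma limit_add0 : left_id limit_zero limit_add.
Proof. by move=> x; apply: inverse_limitP => i /=; rewrite add0r. Qed.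

Lemma limit_addN : left_inverse limit_zero limit_opp limit_add.
Proof. by move=> x; apply: inverse_limitP => i /=; rewrite addNr. Qed.

HB.instance Definition _ := GRing.isZmodule.Build inverse_limit
  limit_addA limit_addC limit_add0 limit_addN.

End InverseLimit.

Section RestrictedMap.
Context (X Y : topologicalType) (f : continuousType X Y).
Context (K K0 : set X) (L L0 : set Y).
Hypotheses (fK : f @` K `<=` L) (fK0 : f @` K0 `<=` L0).

Definition restrict_fun (x : set_type K) : set_type L :=
  exist _ (f (set_val x)) (mem_set (fK (imageP f (set_valP x)))).

Lemma restrict_fun_continuous : continuous restrict_fun.
Proof.
apply: continuous_set_type => x.
apply: (continuous_comp (f := set_val) (g := f)).
  exact: set_val_continuous.
exact: cts_fun.
Qed.

HB.instance Definition _ :=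
  @isContinuous.Build _ _ restrict_fun restrict_fun_continuous.

Lemma restrict_fun_sub :
  restrict_fun @` trace K K0 `<=` trace L L0.
Proof. by move=> _ [x K0x <-] /=; apply: fK0; exists (set_val x). Qed.

Definition restrict_map : pair_map (trace K K0) (trace L L0) :=
  PairMap (pair_map_fun := restrict_fun) restrict_fun_sub.

End RestrictedMap.

Record compact_pair (X : topologicalType) (X0 : set X) := CompactPair {
  pair_K : set X ;
  pair_K0 : set X ;
  pair_K_compact : compact pair_K ;
  pair_K0_compact : compact pair_K0 ;
  pair_K0_K : pair_K0 `<=` pair_K ;
  pair_K0_sub : pair_K0 `<=` X0 }.

Definition compact_pair_le (X : topologicalType) (X0 : set X)
    (P Q : compact_pair X0) : Prop :=
  pair_K P `<=` pair_K Q /\ pair_K0 P `<=` pair_K0 Q.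

Section ImagePair.
Context (X Y : topologicalType) (X0 : set X) (Y0 : set Y).
Context (f : pair_map X0 Y0) (P : compact_pair X0).

Lemma image_pair_compact (K : set X) : compact K -> compact (f @` K).
Proof.
apply: continuous_compact; apply: continuous_subspaceT; exact: cts_fun.
Qed.

Definition image_pair : compact_pair Y0 := CompactPair
  (image_pair_compact (@pair_K_compact _ _ P))
  (image_pair_compact (@pair_K0_compact _ _ P))
  (image_subset f (@pair_K0_K _ _ P))
  (subset_trans (image_subset f (@pair_K0_sub _ _ P)) (@pair_map_sub _ _ _ _ f)).

End ImagePair.

Section Shape.
Context (R : realType) (G : zmodType).

Definition compact_cohomology (X : topologicalType) (X0 : set X) (n : nat)
    (P : compact_pair X0) : zmodType :=
  cohomology R G (trace (pair_K P) (pair_K0 P)) n.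

Section Bonding.
Context (X : topologicalType) (X0 : set X) (n : nat) (P Q : compact_pair X0).
Context (PQ : compact_pair_le P Q).

Lemma bonding_sub (A B : set X) : A `<=` B -> idfun @` A `<=` B.
Proof. by rewrite image_id. Qed.

Definition bonding :
    {additive compact_cohomology n Q -> compact_cohomology n P} :=
  @cohomology_map R G _ _ _ _
    (restrict_map (f := idfun) (bonding_sub PQ.1) (bonding_sub PQ.2)) n.

End Bonding.

Definition shape_cohomology (X : topologicalType) (X0 : set X) (n : nat) :
    zmodType :=
  inverse_limit (@bonding X X0 n).

Section ShapeMap.
Context (X Y : topologicalType) (X0 : set X) (Y0 : set Y).
Context (f : pair_map X0 Y0) (n : nat).

Definition corestrict (P : compact_pair X0) :
    pair_map (trace (pair_K P) (pair_K0 P))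
      (trace (pair_K (image_pair f P)) (pair_K0 (image_pair f P))) :=
  restrict_map (f := f) (@subset_refl _ (f @` pair_K P))
    (@subset_refl _ (f @` pair_K0 P)).

Definition shape_map_fun (x : shape_cohomology Y0 n) (P : compact_pair X0) :
    compact_cohomology n P :=
  cohomology_map (corestrict P) (x (image_pair f P)).

Lemma shape_map_compat (x : shape_cohomology Y0 n) (P Q : compact_pair X0)
    (PQ : compact_pair_le P Q) :
  bonding n PQ (shape_map_fun x Q) = shape_map_fun x P.
Proof.
have fPQ : compact_pair_le (image_pair f P) (image_pair f Q).
  by split; apply: image_subset; [exact: PQ.1|exact: PQ.2].
rewrite /shape_map_fun -(limit_compat x fPQ).
apply: cohomology_map_square => t; exact: val_inj.
Qed.

Definition shape_map (x : shape_cohomology Y0 n) : shape_cohomology X0 n :=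
  InverseLimit (shape_map_compat x).

Lemma shape_map_zmod_morphism : zmod_morphism shape_map.
Proof.
move=> x y; apply: inverse_limitP => P; exact: raddfB.
Qed.

HB.instance Definition _ :=
  GRing.isZmodMorphism.Build _ _ shape_map shape_map_zmod_morphism.

End ShapeMap.
End Shape.
Arguments shape_map R G {X Y X0 Y0} f n x.

Section SubspaceInclusion.
Context (X : topologicalType) (A X0 A0 : set X) (A0X0 : A0 `<=` X0).

Lemma subspace_inclusion_sub :
  set_val @` trace A A0 `<=` X0.
Proof. by move=> _ [x A0x <-]; exact: A0X0. Qed.

Definition subspace_inclusion : pair_map (trace A A0) X0 :=
  PairMap (pair_map_fun := set_val) subspace_inclusion_sub.

End SubspaceInclusion.

(* Main.v *)
From HB Require Import structures.
Require Import Defs.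
From mathcomp Require Import all_boot all_order all_algebra.
From mathcomp Require Import zify ring.
From mathcomp Require Import all_classical reals topology normedtype sequences.

(** Both sides are inverse limits over compact pairs, so the proof combines
    excision in singular cohomology with a cofinality argument.

    Restricting a compact pair [(K, K0)] of [(X, X0)] to the complement of [W]
    gives a compact pair of [(X \ W, X0 \ W)].  Singular excision makes the
    induced map in cohomology an isomorphism as soon as the interior of [K0] in
    [K] contains the trace of [closure W] ([excisive_cover]).  Every compact
    pair can be enlarged to one with this property ([excisive_cofinal]): [K] is
    compact Hausdorff, hence normal, so a compact neighbourhood in [K] of
    [K `&` closure W] fits inside [interior X0] and can be added to [K0].  A
    compatible family is determined by its values on these excisive pairs, and
    may be prescribed there ([cofinal_extension]); [shape_excision] follows.

    Singular excision ([excision]) rests on the acyclicity of the complex of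
    cochains that vanish on the simplices contained in one of two sets whose
    interiors cover the space ([small_cocycle_coboundary]).  With [S] the
    transpose of barycentric subdivision and [T] that of its chain homotopy to
    the identity, a cocycle [c] satisfies [c - S c = d (T c)].  Iterating, [c] is
    the coboundary of the sum over [k] of [T (S^k c)]; the sum is finite at each
    simplex since iterated subdivision makes every simplex small
    ([small_iter_subdivision]).

    The operators [S] and [T] are defined by coning from barycenters
    ([subdivision_boundary], [subdivision_homotopyE]) on functions of affine
    simplices of a standard simplex.  Affine simplices are stochastic matrices,
    so iterated subdivision is matrix multiplication, and the shrinking of the
    mesh is the contraction property of stochastic matrices with a common
    bounded-below column ([spread_le_pivot]). *)

Set Implicit Arguments.
Unset Strict Implicit.
Unset Printing Implicit Defensive.

Import Order.TTheory GRing.Theory Num.Theory.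
Import numFieldNormedType.Exports.

Local Open Scope classical_set_scope.
Local Open Scope ring_scope.

(** * Affine simplices as stochastic matrices *)

Section AffineSimplices.
Context (R : realType).

(** Row [i] of the matrix is the [i]-th vertex, in barycentric coordinates of
    the standard [m]-simplex.  The composite of two affine maps is then the
    product of their matrices. *)
Definition stochastic p m (A : 'M[R]_(p.+1, m.+1)) : Prop :=
  forall i, std_simplex_set R m (row i A).

Record affine_simplex p m := AffineSimplex {
  vertices :> 'M[R]_(p.+1, m.+1) ;
  verticesP : stochastic vertices }.

Lemma affine_simplexP p m (A B : affine_simplex p m) :
  (forall i j, A i j = B i j) -> A = B.
Proof.
case: A B => [A hA] [B hB] /= /matrixP AB; rewrite AB in hA *.
by congr AffineSimplex; exact: Prop_irrelevance.
Qed.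

Lemma vertices_ge0 p m (A : affine_simplex p m) i j : 0 <= A i j.
Proof. by have [/(_ j)] := verticesP A i; rewrite mxE. Qed.

Lemma vertices_sum1 p m (A : affine_simplex p m) i : \sum_j A i j = 1.
Proof.
by have [_ <-] := verticesP A i; apply: eq_bigr => j _; rewrite mxE.
Qed.

Lemma stochasticP p m (A : 'M[R]_(p.+1, m.+1)) :
  (forall i j, 0 <= A i j) -> (forall i, \sum_j A i j = 1) -> stochastic A.
Proof.
move=> A0 A1 i; split=> [j|]; first by rewrite mxE.
by rewrite -(A1 i); apply: eq_bigr => j _; rewrite mxE.
Qed.

Lemma stochastic_id p : stochastic (1%:M : 'M[R]_p.+1).
Proof.
apply: stochasticP => [i j|i]; first by rewrite mxE ler0n.
rewrite (bigD1 i) //= big1 ?addr0 ?mxE ?eqxx // => j.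
by rewrite mxE eq_sym => /negbTE->.
Qed.

Definition id_simplex p : affine_simplex p p := AffineSimplex (@stochastic_id p).

Lemma stochastic_mul p q m (B : affine_simplex p q) (A : affine_simplex q m) :
  stochastic (B *m A).
Proof.
apply: stochasticP => [i j|i].
  by rewrite mxE sumr_ge0 // => k _; rewrite mulr_ge0 ?vertices_ge0.
under eq_bigr do rewrite mxE.
rewrite exchange_big /= -[RHS](vertices_sum1 B i).
by apply: eq_bigr => k _; rewrite -mulr_sumr vertices_sum1 mulr1.
Qed.

Definition affine_mul p q m (B : affine_simplex p q) (A : affine_simplex q m) :
    affine_simplex p m :=
  AffineSimplex (stochastic_mul B A).

Lemma affine_mulA p q m l (C : affine_simplex p q) (B : affine_simplex q m)
    (A : affine_simplex m l) :
  affine_mul (affine_mul C B) A = affine_mul C (affine_mul B A).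
Proof. by apply: affine_simplexP => i j /=; rewrite mulmxA. Qed.

Lemma affine_mul1 p m (A : affine_simplex p m) :
  affine_mul (id_simplex p) A = A.
Proof. by apply: affine_simplexP => i j /=; rewrite mul1mx. Qed.

Lemma stochastic_facet p m (i : 'I_p.+2) (A : affine_simplex p.+1 m) :
  stochastic (row' i A).
Proof.
apply: stochasticP => [k j|k]; first by rewrite mxE vertices_ge0.
by rewrite -(vertices_sum1 A (lift i k)); apply: eq_bigr => j _; rewrite mxE.
Qed.

Definition facet p m (i : 'I_p.+2) (A : affine_simplex p.+1 m) :
    affine_simplex p m :=
  AffineSimplex (stochastic_facet i A).

Lemma facet_mul p q m i (B : affine_simplex p.+1 q) (A : affine_simplex q m) :
  facet i (affine_mul B A) = affine_mul (facet i B) A.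
Proof.
apply: affine_simplexP => k j; rewrite !mxE.
by apply: eq_bigr => l _; rewrite mxE.
Qed.

(** The apex comes first, so that facet [0] is the base and the other facets
    are the cones over the facets of the base. *)
Definition cone_mx p m (v : affine_simplex 0 m) (A : affine_simplex p m) :
    'M[R]_(p.+2, m.+1) :=
  \matrix_(i, j) if unlift ord0 i is Some k then A k j else v ord0 j.

Lemma stochastic_cone p m (v : affine_simplex 0 m) (A : affine_simplex p m) :
  stochastic (cone_mx v A).
Proof.
apply: stochasticP => [i j|i].
  by rewrite mxE; case: unliftP => [k|] _; exact: vertices_ge0.
case: (unliftP ord0 i) => [k|] ->.
  by rewrite -(vertices_sum1 A k); apply: eq_bigr => j _; rewrite mxE liftK.
rewrite -(vertices_sum1 v ord0); apply: eq_bigr => j _.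
by rewrite mxE unlift_none.
Qed.

Definition cone p m (v : affine_simplex 0 m) (A : affine_simplex p m) :
    affine_simplex p.+1 m :=
  AffineSimplex (stochastic_cone v A).

Lemma cone_mul p q m (v : affine_simplex 0 q) (B : affine_simplex p q)
    (A : affine_simplex q m) :
  affine_mul (cone v B) A = cone (affine_mul v A) (affine_mul B A).
Proof.
apply: affine_simplexP => i j; rewrite !mxE.
case: (unliftP ord0 i) => [k|] ->; rewrite ?liftK ?unlift_none /= ?mxE;
  by apply: eq_bigr => l _; rewrite mxE ?liftK ?unlift_none.
Qed.

Lemma facet0_cone p m (v : affine_simplex 0 m) (A : affine_simplex p m) :
  facet ord0 (cone v A) = A.
Proof. by apply: affine_simplexP => i j; rewrite !mxE liftK. Qed.

Lemma facetS_cone p m (v : affine_simplex 0 m) (A : affine_simplex p.+1 m)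
    (i : 'I_p.+2) :
  facet (lift ord0 i) (cone v A) = cone v (facet i A).
Proof.
apply: affine_simplexP => k j; rewrite !mxE.
case: (unliftP ord0 k) => [l|] ->.
  rewrite (_ : lift (lift ord0 i) _ = lift ord0 (lift i l)) ?liftK ?mxE //.
  by apply: val_inj => /=; rewrite /bump /= !add1n ltnS addnS.
rewrite (_ : lift (lift ord0 i) ord0 = ord0) ?unlift_none //.
exact: val_inj.
Qed.

Lemma facet1_cone m (v A : affine_simplex 0 m) :
  facet (lift ord0 ord0) (cone v A) = v.
Proof.
apply: affine_simplexP => i j; rewrite !mxE (ord1 i).
rewrite (_ : lift (lift ord0 ord0) _ = ord0) ?unlift_none //.
exact: val_inj.
Qed.

Lemma stochastic_centroid p : stochastic (const_mx p.+1%:R^-1 : 'M[R]_(1, p.+1)).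
Proof.
apply: stochasticP => [i j|i]; first by rewrite mxE invr_ge0 ler0n.
under eq_bigr do rewrite mxE.
by rewrite sumr_const card_ord -[LHS]mulr_natr mulVf // pnatr_eq0.
Qed.

Definition centroid p : affine_simplex 0 p := AffineSimplex (@stochastic_centroid p).

Definition barycenter p m (A : affine_simplex p m) : affine_simplex 0 m :=
  affine_mul (centroid p) A.

Lemma barycenter_mul p q m (B : affine_simplex p q) (A : affine_simplex q m) :
  barycenter (affine_mul B A) = affine_mul (barycenter B) A.
Proof. by rewrite /barycenter affine_mulA. Qed.

Lemma barycenter_point m (A : affine_simplex 0 m) : barycenter A = A.
Proof.
by apply: affine_simplexP => i j; rewrite !ord1 !mxE big_ord1 !mxE invr1 mul1r.
Qed.

End AffineSimplices.
Arguments id_simplex {R} p.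

(** * Barycentric subdivision and its homotopy *)

Section Subdivision.
Context (R : realType) (G : zmodType).

Local Notation affine p m := (affine_simplex R p m).

(** Chains never appear: a natural chain operator is represented by its
    transpose, acting on functions of affine simplices, and an identity
    between chains becomes an identity valid for all such functions. *)
Definition dual_boundary p m (f : affine p m -> G) (A : affine p.+1 m) : G :=
  \sum_(i < p.+2) f (facet i A) *~ (-1) ^+ i.

Lemma dual_boundaryB p m (f g : affine p m -> G) :
  dual_boundary (f - g) = dual_boundary f - dual_boundary g.
Proof.
apply/funext => A; rewrite /dual_boundary !fctE -sumrB.
by apply: eq_bigr => i _; rewrite mulrzBl.
Qed.

Lemma dual_boundaryD p m (f g : affine p m -> G) :
  dual_boundary (f + g) = dual_boundary f + dual_boundary g.
Proof.
apply/funext => A; rewrite /dual_boundary !fctE -big_split /=.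
by apply: eq_bigr => i _; rewrite mulrzDl.
Qed.

Lemma dual_boundary0 p m : dual_boundary (0 : affine p m -> G) = 0.
Proof. by rewrite -[X in dual_boundary X](subrr 0) dual_boundaryB subrr. Qed.

Lemma comp_subl (T U : Type) (f g : U -> G) (h : T -> U) :
  (f - g) \o h = (f \o h) - (g \o h).
Proof. by []. Qed.

(** Naturality of an operator means that it commutes with [precomp A]. *)
Definition precomp p q m (A : affine q m) (f : affine p m -> G) :
    affine p q -> G :=
  fun B => f (affine_mul B A).

Lemma dual_boundary_mul p q m (f : affine p m -> G) (A : affine q m) :
  dual_boundary (precomp A f) = precomp A (dual_boundary f).
Proof.
by apply/funext => B; apply: eq_bigr => i _; rewrite /= facet_mul.
Qed.

(** Omitting vertex [i] and then vertex [j] of what remains omits the ordered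
    pair of distinct vertices [i] and [lift i j].  The two orders of a pair
    contribute opposite signs. *)
Lemma dual_boundary_square p m (f : affine p m -> G) :
  dual_boundary (dual_boundary f) = 0.
Proof.
apply/funext => A; rewrite -[RHS]/(0 : G) /dual_boundary.
(* Signed contribution of the ordered pair of omitted vertices [i], [i']. *)
pose g (i i' : 'I_p.+3) : G := if unlift i i' is Some j
  then f (facet j (facet i A)) *~ ((-1) ^+ j * (-1) ^+ i) else 0.
transitivity (\sum_i \sum_i' g i i').
  apply: eq_bigr => i _; rewrite (bigD1_ord i) //= /g unlift_none add0r mulrz_suml.
  by apply: eq_bigr => j _; rewrite liftK mulrzA.
have gN (i i' : 'I_p.+3) : (i < i')%N -> g i i' = - g i' i.
  move=> ii'; rewrite /g; case: unliftP => [j ij|ij]; last by rewrite ij ltnn in ii'.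
  case: unliftP => [j' ij'|ij']; last by rewrite ij' ltnn in ii'.
  have [vj vj'] : i' = j.+1 :> nat /\ i = j' :> nat.
    have := congr1 val ij; have := congr1 val ij'.
    by rewrite /= /bump; case: leqP => ?; case: leqP => ?; lia.
  rewrite vj vj' exprS mulN1r mulrN mulrNz opprK.
  congr (f _ *~ _); last exact: mulrC.
  apply: affine_simplexP => k l; rewrite !mxE; congr (vertices _ _ _).
  apply: val_inj; rewrite /= vj vj' /bump.
  by case: (leqP j k) => ?; case: (leqP j' k) => ?; do ![case: leqP => ? //]; lia.
transitivity (\sum_(i : 'I_p.+3) \sum_(i' : 'I_p.+3 | (i < i')%N)
    (g i i' + g i' i)); last first.
  by apply: big1 => i _; apply: big1 => i' /gN->; rewrite addNr.
under [RHS]eq_bigr do rewrite big_split /=.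
rewrite [RHS]big_split /= [X in _ = _ + X](exchange_big_dep xpredT) //= -big_split /=.
apply: eq_bigr => i _.
rewrite (bigID (fun i' : 'I_p.+3 => i < i')%N) /=; congr (_ + _).
rewrite (bigD1 i) /= ?ltnn // {1}/g unlift_none add0r.
by apply: eq_bigl => i'; rewrite -leqNgt ltn_neqAle andbC.
Qed.

(** Transpose of barycentric subdivision: cone the subdivided boundary off from
    the barycenter. *)
Fixpoint subdivision n m : (affine n m -> G) -> affine n m -> G :=
  if n is n'.+1 then fun f A =>
    dual_boundary (subdivision (f \o cone (barycenter A))) A
  else id.

(** Transpose of the chain [T s = cone (s - T (boundary s))], the apex being
    the barycenter of [s]. *)
Fixpoint subdivision_homotopy n m : (affine n.+1 m -> G) -> affine n m -> G :=
  match n with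
  | 0 => fun f A => f (cone (barycenter A) A)
  | n'.+1 => fun f A => f (cone (barycenter A) A) -
      dual_boundary (subdivision_homotopy (f \o cone (barycenter A))) A
  end.

Lemma subdivisionS n m (f : affine n.+1 m -> G) A :
  subdivision f A = dual_boundary (subdivision (f \o cone (barycenter A))) A.
Proof. by []. Qed.

Lemma subdivision_homotopyS n m (f : affine n.+2 m -> G) A :
  subdivision_homotopy f A = f (cone (barycenter A) A) -
    dual_boundary (subdivision_homotopy (f \o cone (barycenter A))) A.
Proof. by []. Qed.

Lemma subdivisionB n m (f g : affine n m -> G) :
  subdivision (f - g) = subdivision f - subdivision g.
Proof.
elim: n f g => [|n IHn] f g //=; apply/funext => A.
by rewrite comp_subl IHn dual_boundaryB.
Qed.

Lemma subdivision_homotopyB n m (f g : affine n.+1 m -> G) :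
  subdivision_homotopy (f - g) =
  subdivision_homotopy f - subdivision_homotopy g.
Proof.
elim: n f g => [|n IHn] f g //=; apply/funext => A.
rewrite comp_subl IHn dual_boundaryB !fctE /=.
by rewrite !opprB addrACA [RHS]addrACA; congr (_ + _); exact: addrC.
Qed.

Lemma subdivision_mul n q m (f : affine n m -> G) (A : affine q m) :
  subdivision (precomp A f) = precomp A (subdivision f).
Proof.
elim: n f => [|n IHn] f //=; apply/funext => B /=.
rewrite (_ : _ \o cone (barycenter B) =
  precomp A (f \o cone (barycenter (affine_mul B A)))).
  by rewrite IHn dual_boundary_mul.
by apply/funext => C /=; rewrite /precomp cone_mul barycenter_mul.
Qed.

Lemma subdivision_homotopy_mul n q m (f : affine n.+1 m -> G) (A : affine q m) :
  subdivision_homotopy (precomp A f) =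
  precomp A (subdivision_homotopy f).
Proof.
elim: n f => [|n IHn] f /=; apply/funext => B /=.
  by rewrite /precomp cone_mul barycenter_mul.
rewrite (_ : _ \o cone (barycenter B) =
  precomp A (f \o cone (barycenter (affine_mul B A)))).
  by rewrite IHn dual_boundary_mul /precomp /= cone_mul barycenter_mul.
by apply/funext => C /=; rewrite /precomp cone_mul barycenter_mul.
Qed.

(** Dual form of [boundary (cone s) = s - cone (boundary s)].  In dimension [0]
    the last term is the apex instead. *)
Lemma dual_boundary_cone p m (f : affine p.+1 m -> G) (v : affine 0 m) :
  dual_boundary f \o cone v = f - dual_boundary (f \o cone v).
Proof.
apply/funext => A; rewrite !fctE /= /dual_boundary big_ord_recl facet0_cone.
rewrite expr0 mulr1z -sumrN; congr (_ + _); apply: eq_bigr => i _.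
by rewrite facetS_cone lift0 exprS mulN1r mulrNz.
Qed.

Lemma dual_boundary_cone0 m (f : affine 0 m -> G) (v A : affine 0 m) :
  dual_boundary f (cone v A) = f A - f v.
Proof.
rewrite /dual_boundary big_ord_recl big_ord1 facet0_cone facet1_cone.
by rewrite expr0 mulr1z expr1 mulrN1z.
Qed.

Lemma subdivision_boundary n m (f : affine n m -> G) :
  subdivision (dual_boundary f) = dual_boundary (subdivision f).
Proof.
elim: n f => [|n IHn] f; apply/funext => A.
  rewrite /= {1}/dual_boundary; under eq_bigr do
    rewrite /= dual_boundary_cone0 mulrzBl.
  rewrite sumrB -[RHS]subr0; congr (_ - _).
  by rewrite big_ord_recl big_ord1 expr0 expr1 mulrN1z mulr1z subrr.
rewrite [LHS]subdivisionS dual_boundary_cone subdivisionB dual_boundaryB IHn.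
by rewrite dual_boundary_square subr0.
Qed.

Lemma subdivision_homotopy0E m (f : affine 0 m -> G) :
  subdivision_homotopy (dual_boundary f) = f - subdivision f.
Proof.
by apply/funext => A; rewrite /= dual_boundary_cone0 barycenter_point.
Qed.

(** Dual form of [boundary T + T boundary = id - subdivision]. *)
Lemma subdivision_homotopyE n m (f : affine n.+1 m -> G) :
  subdivision_homotopy (dual_boundary f) =
  f - subdivision f - dual_boundary (subdivision_homotopy f).
Proof.
(* The induction step only uses the coboundary of the identity one
   dimension below, where dimension 0 fits the general pattern. *)
have key k (h : affine k.+1 m -> G) :
    (forall g : affine k m -> G,
      dual_boundary (subdivision_homotopy (dual_boundary g)) =
      dual_boundary (g - subdivision g)) ->
    subdivision_homotopy (dual_boundary h) =
    h - subdivision h - dual_boundary (subdivision_homotopy h).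
  move=> dTd; apply/funext => A; rewrite subdivision_homotopyS.
  rewrite -[dual_boundary h (cone _ _)]/((dual_boundary h \o cone _) A).
  rewrite dual_boundary_cone subdivision_homotopyB dual_boundaryB dTd.
  rewrite dual_boundaryB !fctE /=.
  by rewrite opprB [LHS]addrA subrKA.
elim: n f => [|n IHn] f; apply: key => g.
  by rewrite subdivision_homotopy0E.
rewrite IHn [LHS]dual_boundaryB dual_boundary_square.
by rewrite subr0.
Qed.

Lemma subdivision_homotopy0 n m : subdivision_homotopy (0 : affine n.+1 m -> G) = 0.
Proof.
by rewrite -[X in subdivision_homotopy X](subrr 0) subdivision_homotopyB subrr.
Qed.

Lemma iter_subdivision0 k n m : iter k (@subdivision n m) 0 = 0.
Proof.
elim: k => // k IHk; rewrite iterS IHk.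
by rewrite -[X in subdivision X](subrr 0) subdivisionB subrr.
Qed.

Lemma iter_subdivision_boundary k n m (f : affine n m -> G) :
  dual_boundary (iter k (@subdivision n m) f) =
  iter k (@subdivision n.+1 m) (dual_boundary f).
Proof. by elim: k => // k IHk; rewrite !iterS -subdivision_boundary IHk. Qed.

Lemma iter_subdivision_mul k n q m (f : affine n m -> G) (A : affine q m) :
  iter k (@subdivision n q) (precomp A f) =
  precomp A (iter k (@subdivision n m) f).
Proof. by elim: k => // k IHk; rewrite !iterS IHk subdivision_mul. Qed.

(** On a cocycle [f], each [subdivision_homotopy (iter k subdivision f)] is a
    primitive of the difference of two consecutive iterates. *)
Lemma telescoping_homotopy K n m (f : affine n.+1 m -> G) :
  dual_boundary f = 0 ->
  dual_boundary (\sum_(k < K) subdivision_homotopy (iter k (@subdivision n.+1 m) f)) =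
  f - iter K (@subdivision n.+1 m) f.
Proof.
move=> df0; elim: K => [|K IHK]; first by rewrite big_ord0 dual_boundary0 subrr.
have := subdivision_homotopyE (iter K (@subdivision n.+1 m) f).
rewrite iter_subdivision_boundary df0 iter_subdivision0 subdivision_homotopy0.
move=> /esym/eqP; rewrite subr_eq0 => /eqP dT.
by rewrite big_ord_recr dual_boundaryD /= IHK -dT subrKA.
Qed.

End Subdivision.

(** * The mesh of iterated subdivisions *)

Section Mesh.
Context (R : realType) (G : zmodType).
Local Notation affine p m := (affine_simplex R p m).

(** Doeblin's condition on the stochastic matrix [C].  The simplices of the
    barycentric subdivision satisfy it: each lies in the star of an original
    vertex, of which all its own vertices have a substantial share. *)
Definition has_pivot n (C : affine n n) : Prop :=
  exists j, forall i, n.+1%:R^-1 <= C i j.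

Lemma subdivision_support n m (f : affine n m -> G) (A : affine n m) :
  (forall C, has_pivot C -> f (affine_mul C A) = 0) -> subdivision f A = 0.
Proof.
elim: n f A => [|n IHn] f A fA.
  rewrite /= -(affine_mul1 A); apply: fA.
  by exists 0 => i; rewrite !ord1 mxE invr1.
rewrite subdivisionS /dual_boundary big1 // => i _.
rewrite IHn ?mul0rz // => C [j Cj] /=.
rewrite -[in facet i A](affine_mul1 A) facet_mul -affine_mulA -cone_mul.
apply: fA; exists (lift i j) => k; rewrite mxE.
case: unliftP => [q|] _; last by rewrite mxE.
rewrite mxE (bigD1 j) //= !mxE eqxx mulr1 big1.
  by rewrite addr0 (le_trans _ (Cj q)) // lef_pV2 ?posrE ?ltr0n // ler_nat.
by move=> l lj; rewrite !mxE (inj_eq lift_inj) (negbTE lj) mulr0.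
Qed.

(** The sup-norm diameter of [A] is at most [w]. *)
Definition spread_le p m (A : affine p m) (w : R) : Prop :=
  forall i i' j, A i j <= A i' j + w.

Lemma spread_le1 p m (A : affine p m) : spread_le A 1.
Proof.
move=> i i' j; rewrite -[leLHS]add0r lerD ?vertices_ge0 //.
rewrite -(vertices_sum1 A i) (bigD1 j) //= lerDl sumr_ge0 // => k _.
exact: vertices_ge0.
Qed.

(** Two rows of [C] share the mass [p.+1%:R^-1] on column [l]; this common part
    cancels in the difference of the corresponding vertices of the product, and
    only the remaining mass sees the spread of [A]. *)
Lemma spread_le_pivot p m (C : affine p p) (A : affine p m) w :
  has_pivot C -> spread_le A w ->
  spread_le (affine_mul C A) ((1 - p.+1%:R^-1) * w).
Proof.
move=> [l Cl] Aw i i' j.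
case: (arg_minP (fun k => A k j) (isT : xpredT (ord0 : 'I_p.+1))) => k0 _ Amin.
(* Measured from their minimum, the [j]-th coordinates lie in [[0, w]]. *)
pose x k := A k j - A k0 j.
have x0 k : 0 <= x k by rewrite subr_ge0 Amin.
have xw k : x k <= w by rewrite lerBlDl Aw.
have CAE k : affine_mul C A k j = A k0 j + \sum_q C k q * x q.
  rewrite mxE -[X in X + _]mul1r -(vertices_sum1 C k) mulr_suml -big_split /=.
  by apply: eq_bigr => q _; rewrite -mulrDr addrC subrK.
have lo : p.+1%:R^-1 * x l <= \sum_q C i' q * x q.
  rewrite (bigD1 l) //= -[leLHS]addr0 lerD ?ler_wpM2r //.
  by rewrite sumr_ge0 // => q _; rewrite mulr_ge0 ?vertices_ge0.
have up : \sum_q C i q * x q <= p.+1%:R^-1 * x l + (1 - p.+1%:R^-1) * w.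
  apply: (@le_trans _ _ (C i l * x l + (1 - C i l) * w)).
    rewrite (bigD1 l) //= lerD2l -(vertices_sum1 C i) [in leRHS](bigD1 l) //=.
    rewrite [_ + _ - _]addrC addKr.
    rewrite mulr_suml ler_sum // => q _; rewrite ler_wpM2l ?vertices_ge0 //.
  rewrite -subr_ge0 (_ : _ - _ = (C i l - p.+1%:R^-1) * (w - x l)); last by ring.
  by rewrite mulr_ge0 ?subr_ge0.
by rewrite !CAE -addrA lerD2l (le_trans up) // lerD2r.
Qed.

Lemma iter_subdivision_support k n m (f : affine n m -> G) (A : affine n m) :
  (forall B, spread_le B ((1 - n.+1%:R^-1) ^+ k) -> f B = 0) ->
  iter k (@subdivision R G n m) f A = 0.
Proof.
suff gen w (B : affine n m) : spread_le B w ->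
    (forall B, spread_le B ((1 - n.+1%:R^-1) ^+ k * w) -> f B = 0) ->
    iter k (@subdivision R G n m) f B = 0.
  by move=> fB; apply: (gen 1) => [|B]; [exact: spread_le1|rewrite mulr1; exact: fB].
elim: k w B => [|k IHk] w B Bw fB; first by apply: fB; rewrite expr0 mul1r.
rewrite iterS; apply: subdivision_support => C pC.
apply: (IHk _ _ (spread_le_pivot pC Bw)) => D; rewrite mulrA -exprSr; exact: fB.
Qed.

End Mesh.

(** * Affine simplices as singular simplices *)

Section Realization.
Context (R : realType).
Local Notation affine p m := (affine_simplex R p m).

Lemma affine_mx_simplex p m (A : affine p m) (t : 'rV[R]_p.+1) :
  std_simplex_set R p t -> std_simplex_set R m (t *m A).
Proof.
move=> [t0 t1]; split=> [j|].
  by rewrite mxE sumr_ge0 // => k _; rewrite mulr_ge0 ?vertices_ge0.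
under eq_bigr do rewrite mxE.
rewrite exchange_big /= -[RHS]t1.
by apply: eq_bigr => k _; rewrite -mulr_sumr vertices_sum1 mulr1.
Qed.

Definition affine_fun p m (A : affine p m) (t : std_simplex R p) :
    std_simplex R m :=
  exist _ (set_val t *m A) (mem_set (affine_mx_simplex A (set_valP t))).

Lemma row_continuous (T : topologicalType) m (f : T -> 'rV[R]_m) :
  (forall j, continuous (fun t => f t 0 j)) -> continuous f.
Proof.
move=> fc t A [P nP sPA]; rewrite nbhs_simpl /=.
have : \forall s \near t, forall j, P 0 j (f s 0 j).
  by apply: filter_forall => j; exact: (fc j t _ (nP 0 j)).
by apply: filterS => s Ps; apply: sPA => i j; rewrite (ord1 i).
Qed.

Lemma affine_fun_continuous p m (A : affine p m) : continuous (affine_fun A).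
Proof.
apply: continuous_set_type; apply: row_continuous => j t /=.
rewrite (_ : (fun t : std_simplex R p => _) =
  (fun x : 'rV[R]_p.+1 => \sum_k x 0 k * A k j) \o set_val); last first.
  by apply/funext => s /=; rewrite mxE.
apply: continuous_comp; first exact: set_val_continuous.
apply: (continuous_big (op := +%R)) => [x|k _]; first exact: add_continuous.
by move=> x; apply: cvgMr_tmp; [exact: nbhs_filter|exact: coord_continuous].
Qed.

HB.instance Definition _ p m (A : affine p m) :=
  @isContinuous.Build _ _ (affine_fun A) (@affine_fun_continuous p m A).

Definition realization p m (A : affine p m) :
    continuousType (std_simplex R p) (std_simplex R m) :=
  affine_fun A.

Lemma realization_id p t : realization (id_simplex p) t = t.
Proof. by apply: val_inj => /=; rewrite mulmx1. Qed.

Lemma realization_mul p q m (B : affine p q) (A : affine q m) t :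
  realization (affine_mul B A) t = realization A (realization B t).
Proof. by apply: val_inj => /=; rewrite mulmxA. Qed.

Lemma realization_facet p m i (A : affine p.+1 m) t :
  realization (facet i A) t = realization A (face R i t).
Proof.
apply: val_inj; apply/rowP => j; rewrite /= !mxE [RHS](bigD1_ord i) //=.
rewrite mxE unlift_none mul0r add0r.
by apply: eq_bigr => k _; rewrite !mxE liftK.
Qed.

Lemma std_simplex_compact n : compact (std_simplex_set R n).
Proof.
apply: (@subclosed_compact _ _
  [set t : 'rV[R]_n.+1 | forall j, `[0 : R, 1]%classic (t ord0 j)]).
- rewrite (_ : std_simplex_set R n =
    \bigcap_(j in [set: 'I_n.+1]) [set t | 0 <= t 0 j] `&`
      [set t | \sum_j t 0 j = 1]); last first.
    apply/seteqP; split=> t [t0 t1]; split=> //= j; last exact: t0.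
    by move=> _; exact: t0.
  apply: closedI.
    apply: closed_bigI => j _.
    have := @coord_continuous R 1 n.+1 0 j.
    by move=> /continuous_closedP/(_ _ (@closed_ge R 0)).
  have : continuous (fun t : 'rV[R]_n.+1 => \sum_j t 0 j).
    apply: (continuous_big (op := +%R)) => [x|j _]; first exact: add_continuous.
    exact: coord_continuous.
  by move=> /continuous_closedP/(_ _ (@closed_eq R 1)).
- exact: (@rV_compact R n.+1 (fun=> `[0, 1]%classic) (fun=> @segment_compact R 0 1)).
- move=> t [t0 t1] j /=; rewrite in_itv /= t0 /= -t1 (bigD1 j) //= lerDl.
  by rewrite sumr_ge0.
Qed.

(** Lebesgue's number lemma for the cover of the standard simplex by the
    preimages of the two interiors. *)
Lemma small_affine_simplex (X : topologicalType) (U V : set X) m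
    (s : singular_simplex R m X) : interior U `|` interior V = setT ->
  exists2 e : R, 0 < e & forall p (A : affine p m), spread_le A e ->
    range (s \o realization A) `<=` U \/ range (s \o realization A) `<=` V.
Proof.
move=> UV.
have pre (W : set X) : exists2 O : set 'rV[R]_m.+1, open O &
    set_val @^-1` O = s @^-1` interior W.
  have /continuousP/(_ _ (@open_interior _ W)) [O oO OW] := @cts_fun _ _ s.
  by exists O.
have [OU oU OUE] := pre U; have [OV oV OVE] := pre V.
have cov : \forall e \near (0 : R)^'+, std_simplex_set R m `<=`
    (fun x => ball x e `<=` OU \/ ball x e `<=` OV).
  apply: ((compact_near_coveringP _).1 (@std_simplex_compact m) R).
  move=> x Dx; pose x' : std_simplex R m := exist _ x (mem_set Dx).
  have half (O : set 'rV[R]_m.+1) : open O -> O x ->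
      \forall x1 \near x & e \near 0^'+, ball x1 e `<=` O.
    move=> oO Ox; have /nbhs_ballP[d /= d0 dO] : nbhs x O by exact: open_nbhs_nbhs.
    exists (ball x (d / 2), [set e | e < d / 2]) => [|[y e] /= [xy ed] z yz].
      split=> /=; first by apply: nbhsx_ballx; rewrite divr_gt0.
      by apply: nbhs_right_lt; rewrite divr_gt0.
    apply: dO; rewrite [d]splitr; apply: ball_triangle xy _.
    exact: le_ball (ltW ed) _ yz.
  have [] : (interior U `|` interior V) (s x') by rewrite UV.
    move=> Ux; have : OU x by have : (set_val @^-1` OU) x' by rewrite OUE.
    by move=> /(half _ oU); apply: filterS => -[y e] /= ?; left.
  move=> Vx; have : OV x by have : (set_val @^-1` OV) x' by rewrite OVE.
  by move=> /(half _ oV); apply: filterS => -[y e] /= ?; right.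
(* The range of an affine simplex lies within its spread of vertex 0, so half
   a Lebesgue number turns the weak bound on the spread into a strict one. *)
have [e [eO e0]] := filter_ex (filterI cov (nbhs_right_gt (0 : R))).
exists (e / 2); first by rewrite divr_gt0.
move=> p A Ae.
have near0 t : ball (row 0 A) e (set_val (realization A t)).
  have [t0 t1] := set_valP t.
  split=> // i j; rewrite (ord1 i) !mxE /ball /=.
  have -> : A 0 j - \sum_k (set_val t) 0 k * A k j =
      \sum_k (set_val t) 0 k * (A 0 j - A k j).
    under [RHS]eq_bigr do rewrite mulrBr; rewrite sumrB; congr (_ - _).
    by rewrite -mulr_suml t1 mul1r.
  apply: (@le_lt_trans _ _ (e / 2)); last by rewrite ltr_pdivrMr // ltr_pMr // ltr1n.
  rewrite -[leRHS]mul1r -[X in _ <= X * _]t1 mulr_suml.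
  rewrite (le_trans (ler_norm_sum _ _ _)) //.
  apply: ler_sum => k _; rewrite normrM ger0_norm ?t0 // ler_wpM2l ?t0 //.
  by rewrite ler_norml lerBrDl lerBlDr Ae lerBlDl Ae.
have sub (O : set 'rV[R]_m.+1) (W : set X) : set_val @^-1` O = s @^-1` interior W ->
    ball (row 0 A) e `<=` O -> range (s \o realization A) `<=` W.
  move=> OW eW _ [t _ <-] /=; apply: interior_subset.
  suff : (set_val @^-1` O) (realization A t) by rewrite OW.
  exact: eW.
by case: (eO _ (verticesP A 0)) => [/(sub _ _ OUE)|/(sub _ _ OVE)]; [left|right].
Qed.

(** The number of subdivisions depends on [s] only, neither on [f] nor on the
    affine simplex at which the iterate is evaluated. *)
Lemma small_iter_subdivision (G : zmodType) (X : topologicalType)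
    (U V : set X) n m (s : singular_simplex R m X) :
  interior U `|` interior V = setT ->
  exists N, forall k, (N <= k)%N -> forall f : affine n m -> G,
    (forall A, range (s \o realization A) `<=` U \/
               range (s \o realization A) `<=` V -> f A = 0) ->
    iter k (@subdivision R G n m) f = 0.
Proof.
move=> UV; have [e e0 small] := small_affine_simplex s UV.
have : (1 - n.+1%:R^-1 : R) ^+ k @[k --> \oo] --> 0.
  apply: cvg_expr; rewrite ger0_norm; first by rewrite ltrBlDr ltrDl invr_gt0 ltr0n.
  by rewrite subr_ge0 invf_le1 ?ler1n ?ltr0n.
move=> /cvgrPdist_le/(_ _ e0)[N _ Nk]; exists N => k /Nk /=.
rewrite sub0r normrN => ke f fsmall; apply/funext => A.
apply: iter_subdivision_support => B Bk; apply: fsmall; apply: small.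
by move=> i i' j; rewrite (le_trans (Bk i i' j)) // lerD2l (le_trans (ler_norm _)).
Qed.

End Realization.

(** * Cochains vanishing on small simplices *)

Section SmallCochains.
Context (R : realType) (G : zmodType) (X : topologicalType).
Local Notation affine p m := (affine_simplex R p m).

(** A cochain of [X] seen as a function of the affine simplices of the domain
    of [s], to which the operators on such functions apply. *)
Definition along m (s : singular_simplex R m X) p (c : cochain R G p X) :
    affine p m -> G :=
  fun A => c (s \o realization A).

Lemma along_coboundary m (s : singular_simplex R m X) p (c : cochain R G p X) :
  along s (coboundary c) = dual_boundary (along s c).
Proof.
apply/funext => A; apply: eq_bigr => i _; congr (c _ *~ _).
by apply/continuousEP => t /=; rewrite -realization_facet.
Qed.

Lemma along_realization m q (s : singular_simplex R m X) (A : affine q m) p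
    (c : cochain R G p X) :
  along (s \o realization A) c = precomp A (along s c).
Proof.
apply/funext => B; congr (c _).
by apply/continuousEP => t /=; rewrite -realization_mul.
Qed.

Lemma along_id p (s : singular_simplex R p X) (c : cochain R G p X) :
  along s c (id_simplex p) = c s.
Proof.
by congr (c _); apply/continuousEP => t /=; congr (s _); exact: realization_id.
Qed.

Lemma coboundary_square p (c : cochain R G p X) :
  coboundary (coboundary c) = 0.
Proof.
apply/funext => s.
by rewrite -along_id !along_coboundary dual_boundary_square.
Qed.

Lemma along_rel_cochain m (s : singular_simplex R m X) (U : set X) p
    (c : cochain R G p X) (A : affine p m) :
  rel_cochain U c -> range (s \o realization A) `<=` U -> along s c A = 0.
Proof. exact. Qed.

Lemma along_rel_cochain0 m (s : singular_simplex R m X) (U : set X) p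
    (c : cochain R G p X) :
  rel_cochain U c -> range s `<=` U -> along s c = 0.
Proof.
move=> cU sU; apply/funext => A; apply: (along_rel_cochain cU).
by move=> _ [t _ <-]; apply: sU; exists (realization A t).
Qed.

(** A primitive of [c] is the infinite sum over [k] of the homotopy applied to
    the [k]-th iterated subdivision of [c].  At each simplex only finitely many
    terms are nonzero, because [c] vanishes on small simplices, and the
    coboundary of the sum telescopes to [c].  Each term vanishes on [U] and on
    [V] by naturality. *)
Lemma small_cocycle_coboundary (U V : set X) n (c : cochain R G n.+1 X) :
  interior U `|` interior V = setT ->
  rel_cochain U c -> rel_cochain V c -> coboundary c = 0 ->
  exists b : cochain R G n X,
    [/\ rel_cochain U b, rel_cochain V b & coboundary b = c].
Proof.
move=> UV cU cV dc.
have evz m (s : singular_simplex R m X) : exists N, forall k, (N <= k)%N ->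
    iter k (@subdivision R G n.+1 m) (along s c) = 0.
  have [N hN] := small_iter_subdivision G n.+1 s UV; exists N => k /hN; apply.
  by move=> A [|]; exact: along_rel_cochain.
pose N s := projT1 (cid (evz n s)).
have N_ge s k : (N s <= k)%N -> iter k (@subdivision R G n.+1 n) (along s c) = 0.
  exact: (projT2 (cid (evz n s))).
pose h m (s : singular_simplex R m X) k : affine n m -> G :=
  subdivision_homotopy (iter k (@subdivision R G n.+1 m) (along s c)).
pose b (s : singular_simplex R n X) := \sum_(k < N s) h n s k (id_simplex n).
have b0 (W : set X) : rel_cochain W c -> rel_cochain W b.
  move=> cW s sW; apply: big1 => k _; rewrite /h (along_rel_cochain0 cW sW).
  by rewrite iter_subdivision0 subdivision_homotopy0.
exists b; split; [exact: b0|exact: b0|apply/funext => s].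
have [K0 hK0] := evz _ s.
pose t i := s \o realization (facet i (id_simplex n.+1)).
(* A common bound for the truncations at [s] and at all its facets. *)
pose K := (\max_i N (t i) + K0)%N.
have bE i : b (t i) = (\sum_(k < K) h n.+1 s k) (facet i (id_simplex n.+1)).
  rewrite fct_sumE /b.
  have hE k : h n (t i) k (id_simplex n) = h n.+1 s k (facet i (id_simplex n.+1)).
    rewrite /h along_realization iter_subdivision_mul subdivision_homotopy_mul.
    by rewrite /precomp affine_mul1.
  under [RHS]eq_bigr do rewrite -hE.
  have NK : (N (t i) <= K)%N.
    by rewrite (leq_trans (leq_bigmax (F := fun i => N (t i)) i)) // leq_addr.
  rewrite -[K](subnKC NK) big_split_ord /= [X in _ + X]big1 ?addr0 // => k _.
  by rewrite /h N_ge ?leq_addr // subdivision_homotopy0.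
rewrite -along_id along_coboundary.
transitivity (dual_boundary (\sum_(k < K) h n.+1 s k) (id_simplex n.+1)).
  by apply: eq_bigr => i _; rewrite -bE.
rewrite telescoping_homotopy; last first.
  by rewrite -along_coboundary dc; apply/funext.
by rewrite hK0 ?leq_addl // subr0 along_id.
Qed.

(** Subdivision is the identity in dimension [0]. *)
Lemma small_cochain0 (U V : set X) (c : cochain R G 0 X) :
  interior U `|` interior V = setT ->
  rel_cochain U c -> rel_cochain V c -> c = 0.
Proof.
move=> UV cU cV; apply/funext => s; rewrite -along_id.
have [N /(_ N (leqnn N))/(_ (along s c)) h] := small_iter_subdivision G 0 s UV.
rewrite (_ : along s c = 0) // -[RHS]h.
  by elim: (N) => // k IHk; rewrite iterS -IHk.
by move=> A [|]; exact: along_rel_cochain.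
Qed.

End SmallCochains.

(** * Excision for singular cohomology *)

Lemma cohomology_class_eq0 (R : realType) (G : zmodType) (X : topologicalType)
    (X0 : set X) n (z : cocycle R G X0 n) :
  cohomology_class z = 0 <-> z \in @is_coboundary R G X X0 n.
Proof.
have <- : cohomology_class (0 : cocycle R G X0 n) = 0.
  by rewrite -[X in cohomology_class X](subrr 0) cohomology_classB subrr.
by rewrite cohomology_class_eq subr0.
Qed.

Lemma rel_cochain_coboundary (R : realType) (G : zmodType) (X : topologicalType)
    (X0 : set X) n (c : cochain R G n X) :
  rel_cochain X0 c -> rel_cochain X0 (coboundary c).
Proof.
move=> cX s sX; apply: big1 => i _; rewrite cX ?mul0rz // => _ [t _ <-].
by apply: sX; exists (face R i t).
Qed.

Lemma bijective_of_surjective (T U : Type) (f : T -> U) :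
  injective f -> (forall y, exists x, f x = y) -> bijective f.
Proof.
move=> fI fS; pose g y := projT1 (cid (fS y)).
have fK y : f (g y) = y := projT2 (cid (fS y)).
by exists g => // x; apply: fI; rewrite fK.
Qed.

(** The hypotheses say that [f] embeds the pair [Y] onto [range f] with the
    trace of [X0], and that [X0] and [range f] satisfy the covering condition of
    excision.  Working with an embedding instead of a subspace avoids
    transporting cochains between iterated subspaces. *)
Section Excision.
Context (R : realType) (G : zmodType) (X Y : topologicalType).
Context (X0 : set X) (Y0 : set Y) (f : pair_map Y0 X0).
Hypothesis f_inj : injective f.
Hypothesis f_initial : forall O : set Y, open O ->
  exists2 O' : set X, open O' & f @^-1` O' = O.
Hypothesis f_X0 : f @^-1` X0 `<=` Y0.
Hypothesis f_cover : interior X0 `|` interior (range f) = setT.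

Lemma simplex_lift n (s : singular_simplex R n X) : range s `<=` range f ->
  exists s' : singular_simplex R n Y, s = f \o s'.
Proof.
move=> sf.
have /choice[g gE] t : exists y, f y = s t.
  by have [|y _ fy] := sf (s t); [exists t|exists y].
have gc : continuous g.
  apply/continuousP => O /f_initial[O' oO' <-].
  have /continuousP/(_ _ oO') := @cts_fun _ _ s.
  by congr open; apply/seteqP; split => t /=; rewrite gE.
pose g' : singular_simplex R n Y := HB.pack g (@isContinuous.Build _ _ g gc).
by exists g'; apply/continuousEP => t /=; rewrite gE.
Qed.

Lemma simplex_lift_uniq n (s t : singular_simplex R n Y) :
  (f \o s : singular_simplex R n X) = f \o t -> s = t.
Proof.
move=> st; apply/continuousEP => x; apply: f_inj.
exact: (congr1 (fun u : singular_simplex R n X => u x) st).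
Qed.

Definition extend_by_zero n (c : cochain R G n Y) : cochain R G n X := fun s =>
  if pselect (exists s' : singular_simplex R n Y, s = f \o s') is left h
  then c (projT1 (cid h)) else 0.

Lemma extend_by_zeroK n (c : cochain R G n Y) :
  pullback f (extend_by_zero c) = c.
Proof.
apply/funext => s; rewrite /pullback /extend_by_zero; case: pselect => [h|[]].
  by congr c; apply: simplex_lift_uniq; exact/esym/(projT2 (cid h)).
by exists s.
Qed.

Lemma rel_cochain_extend_by_zero n (c : cochain R G n Y) :
  rel_cochain Y0 c -> rel_cochain X0 (extend_by_zero c).
Proof.
move=> cY s sX; rewrite /extend_by_zero; case: pselect => // h; apply: cY.
case: (cid h) => s' /= s'E _ [t _ <-]; apply: f_X0; apply: sX.
by exists t => //; rewrite s'E.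
Qed.

Lemma rel_cochain_range n (c : cochain R G n X) :
  pullback f c = 0 -> rel_cochain (range f) c.
Proof.
move=> fc s /simplex_lift[s' ->].
exact: (congr1 (fun d : cochain R G n Y => d s') fc).
Qed.

Lemma pullbackB n (c d : cochain R G n X) :
  pullback f (c - d) = pullback f c - pullback f d.
Proof. by []. Qed.

(** If [pullback f z] is the coboundary of [b], then [z] differs from the
    coboundary of the extension of [b] by a cocycle that vanishes on the
    simplices of [X0] and of [range f], hence is a relative coboundary. *)
Theorem excision_injective n : injective (@cohomology_map R G Y X Y0 X0 f n).
Proof.
apply: raddf_inj => x; rewrite -(cohomology_class_repr x).
case: (repr x) => z zP.
rewrite /= cohomology_mapE => /cohomology_class_eq0/asboolP.
have /asboolP[zX dz] := zP => fz.
apply/cohomology_class_eq0/asboolP.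
have small m (b : cochain R G m X) : rel_cochain X0 b -> pullback f b = 0 ->
    coboundary b = 0 -> rel_coboundary X0 b.
  case: m b => [|m] b bX /rel_cochain_range fb db /=.
    exact: small_cochain0 f_cover bX fb.
  by have [a [aX _ <-]] := small_cocycle_coboundary f_cover bX fb db; exists a.
case: n {x} z zP zX dz fz => [|n] z zP zX dz fz; first exact: small.
have [b bY bz] := fz.
have [|||a aX az] := small _ (z - coboundary (extend_by_zero b)).
- apply: rel_cochainB => //; apply: rel_cochain_coboundary.
  exact: rel_cochain_extend_by_zero.
- by rewrite pullbackB -coboundary_pullback extend_by_zeroK bz subrr.
- by rewrite coboundaryB dz coboundary_square subr0.
exists (a - (0 - extend_by_zero b)).
  apply: rel_cochainB => //; apply: rel_cochainB; first exact: rel_cochain0.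
  exact: rel_cochain_extend_by_zero.
by rewrite !coboundaryB az coboundary0 sub0r opprK subrK.
Qed.

(** The extension [e] of a cocycle need not be a cocycle, but its coboundary
    vanishes on small simplices, so it is also the coboundary of some [b] that
    vanishes on small simplices; [e - b] is a cocycle with the same
    restriction as [e]. *)
Theorem excision_surjective n (y : cohomology R G Y0 n) :
  exists x, cohomology_map f x = y.
Proof.
rewrite -(cohomology_class_repr y); case: (repr y) => z zP.
have /asboolP[zY dz] := zP.
have eX := rel_cochain_extend_by_zero zY.
have fde : pullback f (coboundary (extend_by_zero z)) = 0.
  by rewrite -coboundary_pullback extend_by_zeroK dz.
have [||||b [bX bf db]] :=
  @small_cocycle_coboundary R G X X0 (range f) n (coboundary (extend_by_zero z)).
- exact: f_cover.
- exact: rel_cochain_coboundary.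
- exact: rel_cochain_range.
- exact: coboundary_square.
have wP : extend_by_zero z - b \in @is_cocycle R G X X0 n.
  apply/asboolP; split; first exact: rel_cochainB.
  by rewrite coboundaryB db subrr.
exists (cohomology_class (Cocycle wP)); rewrite cohomology_mapE.
congr cohomology_class; apply: val_inj => /=.
rewrite pullbackB extend_by_zeroK -[RHS]subr0; congr (_ - _).
apply/funext => s; apply: bf => _ [t _ <-] /=; by exists (s t).
Qed.

Theorem excision n : bijective (@cohomology_map R G Y X Y0 X0 f n).
Proof.
by apply: bijective_of_surjective;
  [exact: excision_injective|exact: excision_surjective].
Qed.

End Excision.

(** * Compact pairs and bonding maps *)

Section SetType.
Context (X : topologicalType) (A : set X).

Lemma compact_trace (K : set X) :
  closed A -> compact K -> compact (trace A K).
Proof.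
move=> cA /compact_closedI/(_ cA) cK F PF FK.
have FKA : (set_val @ F) (K `&` A).
  rewrite /fmap /=; apply: filterS FK => x Kx; split => //; exact: set_valP.
have [x [[Kx Ax] clx]] := cK _ _ FKA.
exists (exist _ x (mem_set Ax)); split => // B C FB.
rewrite nbhsE => -[_ [[O oO <-] Ox] OC].
have FvB : F (set_val @^-1` (set_val @` B)) by apply: filterS FB => y By; exists y.
have nO : nbhs x O by exact: open_nbhs_nbhs.
by have [_ [[y By <-] Oy]] := clx _ _ FvB nO; exists y; split => //; apply: OC.
Qed.

Lemma hausdorff_set_type : hausdorff_space X -> hausdorff_space (set_type A).
Proof.
move=> hX p q pq; apply: val_inj; apply: hX => B C nB nC.
have [x [Bx Cx]] := pq _ _ (set_val_continuous nB) (set_val_continuous nC).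
by exists (set_val x).
Qed.

End SetType.

Section CompactPairs.
Context (X : topologicalType) (X0 : set X).

Lemma compact_pair_le_refl (P : compact_pair X0) : compact_pair_le P P.
Proof. by split. Qed.

Lemma compact_pair_le_trans (P Q T : compact_pair X0) :
  compact_pair_le P Q -> compact_pair_le Q T -> compact_pair_le P T.
Proof.
by move=> [PQ PQ0] [QT QT0]; split; [exact: subset_trans QT|exact: subset_trans QT0].
Qed.

Lemma compact_pair_directed (P Q : compact_pair X0) :
  exists2 T, compact_pair_le P T & compact_pair_le Q T.
Proof.
pose T := @CompactPair X X0 (pair_K P `|` pair_K Q) (pair_K0 P `|` pair_K0 Q)
  (compactU (@pair_K_compact _ _ P) (@pair_K_compact _ _ Q))
  (compactU (@pair_K0_compact _ _ P) (@pair_K0_compact _ _ Q))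
  (setUSS (@pair_K0_K _ _ P) (@pair_K0_K _ _ Q)).
have h : pair_K0 P `|` pair_K0 Q `<=` X0.
  by rewrite subUset; split; exact: pair_K0_sub.
by exists (T h); split; by [left|right].
Qed.

End CompactPairs.

Section Bonding.
Context (R : realType) (G : zmodType).

Lemma cohomology_map_comp (X Y Z : topologicalType)
    (X0 : set X) (Y0 : set Y) (Z0 : set Z)
    (f : pair_map X0 Y0) (g : pair_map Y0 Z0) (h : pair_map X0 Z0) n
    (x : cohomology R G Z0 n) :
  (forall t, g (f t) = h t) ->
  cohomology_map f (cohomology_map g x) = cohomology_map h x.
Proof.
move=> gf; rewrite -(cohomology_class_repr x) !cohomology_mapE.
congr cohomology_class; apply: val_inj; apply/funext => s /=.
by rewrite /pullback; congr (cocycle_val _ _); apply/continuousEP => t /=.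
Qed.

Lemma bonding_comp (X : topologicalType) (X0 : set X) n
    (P Q T : compact_pair X0) (PQ : compact_pair_le P Q)
    (QT : compact_pair_le Q T) (PT : compact_pair_le P T)
    (x : compact_cohomology R G n T) :
  bonding R G n PQ (bonding R G n QT x) = bonding R G n PT x.
Proof. by apply: cohomology_map_comp => t; exact: val_inj. Qed.

Lemma bonding_id (X : topologicalType) (X0 : set X) n
    (P : compact_pair X0) (PP : compact_pair_le P P) (x : compact_cohomology R G n P) :
  bonding R G n PP x = x.
Proof.
rewrite -[x in RHS]cohomology_class_repr -{1}(cohomology_class_repr x).
rewrite [LHS]cohomology_mapE; congr cohomology_class; apply: val_inj.
apply/funext => s /=; rewrite /pullback; congr (cocycle_val _ _).
by apply/continuousEP => t; exact: val_inj.
Qed.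

End Bonding.

(** * Inverse limits and cofinal subsets *)

Section CofinalExtension.
Context (I : Type) (le : I -> I -> Prop) (M : I -> zmodType).
Context (bond : forall i j, le i j -> {additive M j -> M i}).
Hypothesis le_refl : forall i, le i i.
Hypothesis le_trans : forall i j k, le i j -> le j k -> le i k.
Hypothesis le_directed : forall i j, exists2 k, le i k & le j k.
Hypothesis bond_id : forall i (ii : le i i) x, bond ii x = x.
Hypothesis bond_comp : forall i j k (ij : le i j) (jk : le j k) (ik : le i k) x,
  bond ij (bond jk x) = bond ik x.
Context (J : set I).
Hypothesis J_cofinal : forall i, exists2 j, le i j & J j.

(** An inverse limit over a directed set can be computed on a cofinal subset:
    define the component at [i] through any index of [J] above [i]. *)
Lemma cofinal_extension (xi : forall i, M i) :
  (forall i j (ij : le i j), J i -> J j -> bond ij (xi j) = xi i) ->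
  exists x : inverse_limit bond, forall j, J j -> x j = xi j.
Proof.
move=> xiJ.
have top i j : exists k, [/\ le i k, le j k & J k].
  have [k ik jk] := le_directed i j; have [l kl Jl] := J_cofinal k.
  by exists l; split => //; [exact: le_trans kl|exact: le_trans kl].
have indep i j k (ij : le i j) (ik : le i k) : J j -> J k ->
    bond ij (xi j) = bond ik (xi k).
  move=> Jj Jk; have [l [jl kl Jl]] := top j k.
  rewrite -(xiJ _ _ jl) // -(xiJ _ _ kl) //.
  by rewrite !(bond_comp _ _ (le_trans ij jl)).
pose up i := cid2 (J_cofinal i).
pose x i := bond (s2valP (up i)) (xi (s2val (up i))).
have Jup i : J (s2val (up i)) := s2valP' (up i).
have xc i j (ij : le i j) : bond ij (x j) = x i.
  rewrite /x (bond_comp _ _ (le_trans ij (s2valP (up j)))).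
  exact: indep.
exists (InverseLimit xc) => j Jj /=.
by rewrite /x (indep _ _ _ _ (le_refl j)) // bond_id.
Qed.

End CofinalExtension.

(** * Excision for shape cohomology *)

Section ShapeExcision.
Context (R : realType) (G : zmodType) (X : topologicalType) (X0 W : set X).
Hypothesis (hX : hausdorff_space X) (oW : open W).
Hypothesis hW : closure W `<=` interior X0.

Local Notation X0W := (trace (~` W) (X0 `\` W)).
Local Notation inc := (subspace_inclusion (~` W) (@subDsetl X X0 W)).

Lemma excised_pair_sub (P : compact_pair X0) :
  trace (~` W) (pair_K0 P) `<=` X0W.
Proof. by move=> x Px; split; [exact: pair_K0_sub Px|exact: (set_valP x)]. Qed.

Definition excised_pair (P : compact_pair X0) : compact_pair X0W := CompactPair
  (compact_trace (open_closedC oW) (@pair_K_compact _ _ P))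
  (compact_trace (open_closedC oW) (@pair_K0_compact _ _ P))
  (preimage_subset (@pair_K0_K _ _ P))
  (@excised_pair_sub P).

Lemma trace_image (A : set X) : inc @` trace (~` W) A `<=` A.
Proof. by move=> _ [x Ax <-]. Qed.

Definition excised_map (P : compact_pair X0) :
    pair_map (trace (pair_K (excised_pair P)) (pair_K0 (excised_pair P)))
      (trace (pair_K P) (pair_K0 P)) :=
  restrict_map (f := inc) (@trace_image (pair_K P)) (@trace_image (pair_K0 P)).

Definition excisive n (P : compact_pair X0) : Prop :=
  bijective (@cohomology_map R G _ _ _ _ (excised_map P) n).

Lemma excisive_cover n (P : compact_pair X0) :
  (forall x : set_type (pair_K P), closure W (set_val x) ->
     interior (trace (pair_K P) (pair_K0 P)) x) ->
  excisive n P.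
Proof.
move=> PW; apply: excision.
- move=> x y /(congr1 set_val) /= xy; apply: val_inj; exact: val_inj.
- move=> O [_ [O' oO' <-] <-].
  by exists (set_val @^-1` O') => //; exists O'.
- by [].
- rewrite -subTset => x _; have [Wx|Wx] := pselect (closure W (set_val x)).
    by left; exact: PW.
  right; apply: (@filterS _ _ _ (set_val @^-1` ~` closure W)).
    move=> y Wy; have Wy' : (~` W) (set_val y).
      by move=> /subset_closure.
    have Ky : trace (~` W) (pair_K P) (exist _ (set_val y) (mem_set Wy')).
      exact: (set_valP y).
    exists (exist _ (exist _ (set_val y) (mem_set Wy')) (mem_set Ky)) => //.
    exact: val_inj.
  apply: set_val_continuous; apply: open_nbhs_nbhs; split => //.
  exact: closed_openC (@closed_closure _ W).
Qed.

(** In the compact Hausdorff space [K], normality gives a closed neighbourhood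
    of the trace of [closure W] inside the trace of [interior X0]; adding it to
    the second component of [P] secures the covering condition. *)
Lemma excisive_cofinal n (P : compact_pair X0) :
  exists2 Q, compact_pair_le P Q & excisive n Q.
Proof.
set K := pair_K P.
have cK : compact K := @pair_K_compact _ _ P.
have cT : compact [set: set_type K].
  have := compact_trace (compact_closed hX cK) cK.
  by congr compact; apply/seteqP; split => // x _; exact: (set_valP x).
have hK := @hausdorff_set_type X K hX.
have clW : closed (trace K (closure W)).
  have /continuous_closedP := @set_val_continuous X K.
  by apply; exact: closed_closure.
have [V /set_nbhsP[O [oO WO OV]] VX] :
    filter_from (set_nbhs (trace K (closure W))) closure (trace K (interior X0)).
  apply: (compact_normal hK cT clW); apply/set_nbhsP.
  exists (trace K (interior X0)); split => //; last by move=> x; exact: hW.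
  have /continuousP := @set_val_continuous X K; apply; exact: open_interior.
pose L := set_val @` closure V : set X.
have cL : compact L.
  apply: continuous_compact.
    by apply: continuous_subspaceT; exact: set_val_continuous.
  exact: subclosed_compact (@closed_closure _ V) cT _.
have LX : L `<=` X0 by move=> _ [x /VX Vx <-]; exact: interior_subset Vx.
have LK : L `<=` K by move=> _ [x _ <-]; exact: (set_valP x).
have K0L : pair_K0 P `|` L `<=` K by rewrite subUset; split => //; exact: pair_K0_K.
have K0LX : pair_K0 P `|` L `<=` X0.
  by rewrite subUset; split => //; exact: pair_K0_sub.
exists (CompactPair cK (compactU (@pair_K0_compact _ _ P) cL) K0L K0LX).
  by split => // x; left.
apply: excisive_cover => /= x Wx.
apply: (@filterS _ _ _ O); last by apply: open_nbhs_nbhs; split => //; exact: WO.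
by move=> y Oy; right; exists y => //; apply: subset_closure; exact: OV.
Qed.

Lemma excised_pair_le (P Q : compact_pair X0) :
  compact_pair_le P Q -> compact_pair_le (excised_pair P) (excised_pair Q).
Proof. by move=> [PQ PQ0]; split => x; [exact: PQ|exact: PQ0]. Qed.

Lemma excised_map_bonding n (P Q : compact_pair X0) (PQ : compact_pair_le P Q)
    (PQ' : compact_pair_le (excised_pair P) (excised_pair Q))
    (x : compact_cohomology R G n Q) :
  cohomology_map (excised_map P) (bonding R G n PQ x) =
  bonding R G n PQ' (cohomology_map (excised_map Q) x).
Proof. by apply: cohomology_map_square => t; exact: val_inj. Qed.

(** Restriction outside [W] of a component of [x] is a component of the image of
    [x], so the latter determines the components of [x] at excisive pairs. *)
Lemma excised_map_shape n (x : shape_cohomology R G X0 n) (P : compact_pair X0) :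
  cohomology_map (excised_map P) (x P) = shape_map R G inc n x (excised_pair P).
Proof.
have le : compact_pair_le (image_pair inc (excised_pair P)) P.
  by split; exact: trace_image.
rewrite /= /shape_map_fun -(limit_compat x le); apply/esym/cohomology_map_comp.
by move=> t; exact: val_inj.
Qed.

(** Injectivity holds because a family is determined by its components at the
    excisive pairs.  For surjectivity, prescribe these components by inverting
    excision and extend them to all compact pairs by cofinality. *)
Theorem shape_excision n : bijective (shape_map R G inc n).
Proof.
apply: bijective_of_surjective => [x x' xx'|y].
  have eqJ P : excisive n P -> x P = x' P.
    by move=> /bij_inj; apply; rewrite !excised_map_shape xx'.
  apply: inverse_limitP => P; have [Q PQ JQ] := excisive_cofinal n P.
  by rewrite -!(limit_compat _ PQ) eqJ.
have xiP P : exists xi : compact_cohomology R G n P, excisive n P ->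
    cohomology_map (excised_map P) xi = y (excised_pair P).
  have [[g _ gK]|nP] := pselect (excisive n P); last by exists 0.
  by exists (g (y (excised_pair P))).
pose xi P := projT1 (cid (xiP P)).
have xiE P : excisive n P ->
    cohomology_map (excised_map P) (xi P) = y (excised_pair P).
  exact: (projT2 (cid (xiP P))).
have xi_compat P Q (PQ : compact_pair_le P Q) : excisive n P -> excisive n Q ->
    bonding R G n PQ (xi Q) = xi P.
  move=> JP JQ; apply: (bij_inj JP).
  by rewrite (excised_map_bonding _ (excised_pair_le PQ)) !xiE // limit_compat.
have [x xE] := cofinal_extension (@compact_pair_le_refl X X0)
  (@compact_pair_le_trans X X0) (@compact_pair_directed X X0) (@bonding_id R G X X0 n)
  (@bonding_comp R G X X0 n) (excisive_cofinal n) xi_compat.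
exists x; apply: inverse_limitP => P.
(* The component of [shape_map x] at [P] factors through the excisive pair [Q]
   above the image of [P], at which [x] is prescribed. *)
have [Q PQ JQ] := excisive_cofinal n (image_pair inc P).
have PQ' : compact_pair_le P (excised_pair Q).
  by split => t Pt; [apply: PQ.1|apply: PQ.2]; exists t.
rewrite -(limit_compat y PQ') -(xiE _ JQ) -(xE _ JQ) /= /shape_map_fun.
rewrite -(limit_compat x PQ); apply: cohomology_map_square => t.
exact: val_inj.
Qed.

End ShapeExcision.

Theorem theorem5p7 (R : realType) (G : zmodType) (X : topologicalType)
    (X0 W : set X) (hX : hausdorff_space X) (oW : open W)
    (hW : closure W `<=` interior X0) (n : nat) :
  bijective
    (shape_map R G (subspace_inclusion (~` W) (@subDsetl X X0 W)) n
      : {additive shape_cohomology R G X0 n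
           -> shape_cohomology R G (trace (~` W) (X0 `\` W)) n}).
Proof. exact: shape_excision. Qed.
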